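(* Let $r \in \mathbb{N}\setminus \{1\}$. Then \[\left \lceil \frac{2^r - 1}{3} \right \rceil \le \mathsf{D}_0(C_2^r)\le \left \lceil \frac{2^r - 1}{3}\right \rceil + 2^{r/2}.\]
   Context: $C_2^r$ is the elementary abelian $2$-group of rank $r$. A sequence over a finite abelian group $G$ is a finite unordered list of elements with repetitions; zero-sum means its terms sum to $0$. $\mathsf{D}_k(G)$ ($k\in\mathbb{N}$) is the smallest $\ell$ such that every sequence over $G$ of length at least $\ell$ has $k$ disjoint non-empty zero-sum subsequences. $\mathsf{D}_0(G)\in\mathbb{N}_0$ denotes the (known to exist) integer such that $\mathsf{D}_k(G)=\mathsf{D}_0(G)+k\exp(G)$ for all sufficiently large $k$. *)

(* Defs.v *)
From Stdlib Require Import Reals.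
From mathcomp Require Import all_boot all_order all_algebra.

Set Implicit Arguments.
Unset Strict Implicit.
Unset Printing Implicit Defensive.
Import GRing.Theory.
Local Open Scope ring_scope.

(* A sequence over G is modelled as s : seq G (order irrelevant for all
   notions below). A subsequence is given by a set of positions. *)

Definition has_k_disjoint_zs (G : finZmodType) (k : nat) (s : seq G) : Prop :=
  exists I : 'I_k -> {set 'I_(size s)},
    (forall j, I j != set0) /\
    (forall j, \sum_(i in I j) s`_i = 0) /\
    (forall j j', j != j' -> [disjoint I j & I j']).

Definition Dk_prop (G : finZmodType) (k l : nat) : Prop :=
  forall s : seq G, (l <= size s)%N -> has_k_disjoint_zs k s.

Definition is_Dk (G : finZmodType) (k l : nat) : Prop :=
  Dk_prop G k l /\ forall l', Dk_prop G k l' -> (l <= l')%N.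

Definition is_exponent (G : finZmodType) (e : nat) : Prop :=
  (0 < e)%N /\ (forall g : G, g *+ e = 0) /\
  (forall n, (0 < n)%N -> (forall g : G, g *+ n = 0) -> (e <= n)%N).

Definition is_D0 (G : finZmodType) (d0 : nat) : Prop :=
  exists e, is_exponent G e /\
  exists K, forall k, (K <= k)%N -> is_Dk G k (d0 + k * e)%N.

Definition C2r (r : nat) : finZmodType := 'rV['F_2]_r.

(* Main.v *)
Require Import Defs.
From Stdlib Require Import Reals Lra Classical.
From mathcomp Require Import all_boot all_order all_algebra zify.

(** In exponent 2, two equal terms lying in different zero-sum blocks can be
    paired off and the rests of the two blocks merged, so equal terms may always
    be assumed paired. Hence D_0 + 1 is the maximum of #|A| - 2 m(A) over sets A
    of non-zero vectors, where m(A) is the largest number of disjoint non-empty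
    zero-sum subsets of A.

    Lower bound: omit one non-zero vector; every block has at least 3 elements.

    Upper bound: take a partial spread, i.e. disjoint zero-sum triples covering
    all but O(1) vectors, built in steps of two dimensions from a permutation phi
    such that v |-> v + phi v is also a permutation. Keep the triples contained
    in A and pack the other elements of A greedily into zero-sum quadruples; by
    pigeonhole this stops only when at most 2 * 2^(r/2) + 1 elements are left. *)

(** * Zero-sum packings of sequences in a finite abelian group *)

Section ZeroSumPackings.
Import GRing.Theory.
Local Open Scope ring_scope.
Variable G : finZmodType.
Implicit Types (s b : seq G) (A B : {set G}) (g x : G).

(** Blocks are peeled off one at a time up to permutation, which avoids positions and suits
    induction on [k]; terms in no block may remain. *)
Fixpoint zs_packing (k : nat) (s : seq G) : Prop :=
  if k is k'.+1 then exists b r : seq G,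
    [/\ b != [::], \sum_(x <- b) x = 0, perm_eq s (b ++ r) & zs_packing k' r]
  else True.

Lemma zs_packing_perm k s1 s2 :
  perm_eq s1 s2 -> zs_packing k s1 -> zs_packing k s2.
Proof.
case: k => //= k p12 [b [r [b0 bz p1 hr]]]; exists b, r; split=> //.
by apply: perm_trans p1; rewrite perm_sym.
Qed.

Lemma zs_packing_catl k b s : zs_packing k s -> zs_packing k (b ++ s).
Proof.
elim: k s => //= k IH s [c [r [c0 cz p1 hr]]]; exists c, (b ++ r); split=> //.
  by rewrite (permPr (permEl (perm_catCA c b r))) perm_cat2l.
exact: IH.
Qed.

Lemma zs_packingW k s : zs_packing k.+1 s -> zs_packing k s.
Proof.
move=> [b [r [_ _ p1 hr]]].
by apply: (zs_packing_perm k (b ++ r)); rewrite 1?perm_sym //; apply: zs_packing_catl.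
Qed.

Lemma zs_packing_leq k l s : (k <= l)%N -> zs_packing l s -> zs_packing k s.
Proof.
move=> /subnK <-; elim: (l - k)%N => //= n IH hs.
by apply: IH; apply: zs_packingW.
Qed.

Lemma zs_packing_block k b s :
  b != [::] -> \sum_(x <- b) x = 0 -> zs_packing k s -> zs_packing k.+1 (b ++ s).
Proof. by move=> b0 bz hs; exists b, s. Qed.

Lemma zs_packing_set k A B : B \subset A -> B != set0 -> \sum_(x in B) x = 0 ->
  zs_packing k (enum (A :\: B)) -> zs_packing k.+1 (enum A).
Proof.
move=> BA B0 Bz hs; apply: (zs_packing_perm _ (enum B ++ enum (A :\: B))).
  apply: uniq_perm; rewrite ?enum_uniq //.
    rewrite cat_uniq !enum_uniq andbT /=; apply/hasPn => x.
    by rewrite !mem_enum inE => /andP[].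
  move=> x; rewrite mem_cat !mem_enum !inE.
  by have := subsetP BA x; case: (x \in B) => //= ->.
apply: zs_packing_block => //; last by rewrite big_enum.
by rewrite -size_eq0 -cardE cards_eq0.
Qed.

Lemma perm_cons_cat_split g s b r : perm_eq (g :: s) (b ++ r) ->
  (exists2 b', perm_eq b (g :: b') & perm_eq s (b' ++ r)) \/
  (exists2 r', perm_eq r (g :: r') & perm_eq s (b ++ r')).
Proof.
move=> p; have: g \in b ++ r by rewrite -(perm_mem p) mem_head.
rewrite mem_cat => /orP[] gi; [left; exists (rem g b)|right; exists (rem g r)];
  rewrite ?perm_to_rem // -(perm_cons g) (perm_trans p) //.
  by rewrite -cat_cons perm_cat2r perm_to_rem.
by rewrite -[g :: _]cat1s perm_sym perm_catCA perm_cat2l perm_sym perm_to_rem.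
Qed.

(** Either [g] is in no block, or [b] is the rest of its block and the other [k] blocks survive in
    [r]. *)
Lemma zs_packing_cons_inv k g s : zs_packing k.+1 (g :: s) ->
  zs_packing k.+1 s \/
  exists b r, [/\ perm_eq s (b ++ r), \sum_(x <- b) x = - g & zs_packing k r].
Proof.
elim: k s => [|k IH] s [b [r [b0 bz p hr]]];
  case: (perm_cons_cat_split _ _ _ _ p) => -[b' pb ps].
- right; exists b', r; split=> //; apply/eqP; rewrite -addr_eq0 addrC.
  by move: bz; rewrite (perm_big _ pb) big_cons => ->.
- by left; exists b, b'.
- right; exists b', r; split=> //; apply/eqP; rewrite -addr_eq0 addrC.
  by move: bz; rewrite (perm_big _ pb) big_cons => ->.
have [h|[c [r2 [pc cz h]]]] := IH _ (zs_packing_perm k.+1 _ _ pb hr).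
  by left; exists b, b'.
right; exists c, (b ++ r2); split=> //; last exact: zs_packing_block.
by rewrite (perm_trans ps) // perm_sym perm_catCA perm_cat2l perm_sym.
Qed.

(* If the two copies of g lie in different blocks, these are merged after
   deleting both copies; only one block is lost. *)
Lemma zs_packing_remove_pair k g s : g + g = 0 -> g != 0 ->
  zs_packing k.+1 (g :: g :: s) -> zs_packing k s.
Proof.
move=> gg g0 /zs_packing_cons_inv[/zs_packing_cons_inv[/zs_packingW //|]|].
  move=> [b [r [p _ h]]]; apply: (zs_packing_perm _ (b ++ r)).
    by rewrite perm_sym.
  exact: zs_packing_catl.
move=> [b [r [p bz h]]]; case: (perm_cons_cat_split _ _ _ _ p) => -[b' pb ps].
  apply: (zs_packing_perm _ (b' ++ r)); first by rewrite perm_sym.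
  exact: zs_packing_catl.
case: k h => // k h.
have [h'|[c [r2 [pc cz h']]]] := zs_packing_cons_inv _ _ _ (zs_packing_perm k.+1 _ _ pb h).
  by apply: (zs_packing_perm _ (b ++ b')); [rewrite perm_sym | apply: zs_packing_catl].
exists (b ++ c), r2; split=> //; last 1 first.
- by rewrite (perm_trans ps) // -catA perm_cat2l.
- by move: g0; rewrite -oppr_eq0 -bz; case: (b) => //; rewrite big_nil eqxx.
by rewrite big_cat /= bz cz -opprD gg oppr0.
Qed.

Lemma zs_packing_remove_pairs p k g s : g + g = 0 -> g != 0 ->
  zs_packing (p + k) (nseq p.*2 g ++ s) -> zs_packing k s.
Proof.
move=> gg g0; elim: p => //= p IH h; apply: IH.
exact: (zs_packing_remove_pair _ g).
Qed.

(** The ambient set [U] lets the induction delete [I ord0] without renumbering positions. *)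
Lemma zs_packing_of_disjoint_sets (T : finType) (w : T -> G) k
    (I : 'I_k -> {set T}) (U : {set T}) :
  (forall j, I j != set0) -> (forall j, \sum_(i in I j) w i = 0) ->
  (forall j j', j != j' -> [disjoint I j & I j']) ->
  (forall j, I j \subset U) -> zs_packing k (map w (enum U)).
Proof.
elim: k I U => // k IH I U I0 Iz Id IU.
apply: (zs_packing_perm _ (map w (enum (I ord0)) ++ map w (enum (U :\: I ord0)))).
  rewrite -map_cat perm_map //; apply: uniq_perm; rewrite ?enum_uniq //.
    rewrite cat_uniq !enum_uniq andbT /=; apply/hasPn => x.
    by rewrite !mem_enum inE => /andP[].
  move=> x; rewrite mem_cat !mem_enum !inE.
  by have := subsetP (IU ord0) x; case: (x \in I ord0) => //= ->.
apply: zs_packing_block.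
- by rewrite -size_eq0 size_map -cardE cards_eq0.
- by rewrite big_map big_enum.
apply: (IH (fun j => I (lift ord0 j))) => // [j j' jj'|j].
  by apply: Id; rewrite (inj_eq lift_inj).
by rewrite subsetD IU Id // eq_sym neq_lift.
Qed.

Lemma perm_map_preim (T : eqType) (w : T -> G) (J : seq T) (y : seq G) :
  perm_eq (map w J) y -> exists2 J', perm_eq J' J & map w J' = y.
Proof.
case: J => [|t J]; first by rewrite perm_sym => /perm_nilP ->; exists [::].
rewrite perm_sym => /(perm_iotaP 0)[Is pI ->].
exists (map (nth t (t :: J)) Is).
  rewrite -[X in perm_eq _ X](mkseq_nth t (t :: J)); apply: perm_map.
  by rewrite -(size_map w).
rewrite -map_comp; apply/eq_in_map => i iI.
rewrite [RHS](nth_map t) //; move: iI.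
by rewrite (perm_mem pI) mem_iota size_map.
Qed.

Lemma zs_packing_coloring (T : eqType) (w : T -> G) k (J : seq T) :
  uniq J -> zs_packing k (map w J) ->
  exists c : T -> nat, forall j, (j < k)%N ->
    (exists2 i, i \in J & c i = j) /\ \sum_(i <- J | c i == j) w i = 0.
Proof.
elim: k J => [|k IH] J uJ; first by exists (fun _ => 0%N).
move=> [b [r [b0 bz p hr]]].
have [J' pJ' eJ'] := perm_map_preim _ _ _ _ p.
have uJ' : uniq J' by rewrite (perm_uniq pJ').
pose J1 := take (size b) J'; pose J2 := drop (size b) J'.
have eJ : J' = J1 ++ J2 by rewrite cat_take_drop.
have e1 : map w J1 = b by rewrite map_take eJ' take_size_cat.
have e2 : map w J2 = r by rewrite map_drop eJ' drop_size_cat.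
move: uJ'; rewrite eJ cat_uniq => /and3P[u1 /hasPn /= d12 u2].
rewrite -e2 in hr; have [c hc] := IH _ u2 hr.
(* Colour [k] marks the new block. Leftover terms may already have colour [k] under [c], so they
   move to the junk colour [k.+1]. *)
exists (fun i => if i \in J1 then k else if (c i < k)%N then c i else k.+1).
move=> j; rewrite ltnS leq_eqVlt => /orP[/eqP ->|jk].
  split.
    move: b0; rewrite -e1; case E: J1 => [|i J1'] // _; exists i.
      by rewrite -(perm_mem pJ') eJ E mem_head.
    by rewrite mem_head.
  rewrite -(perm_big _ pJ') eJ /= big_cat /= [X in _ + X]big1_seq ?addr0.
    rewrite -[RHS]bz -e1 big_map big_seq_cond [RHS]big_seq.
    by apply: eq_bigl => i; case: (i \in J1); rewrite //= eqxx.
  move=> i /andP[+ /d12 /negbTE i1]; rewrite i1.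
  by case: ltnP => h /eqP e; exfalso; lia.
have [[i iJ ci] cz] := hc j jk; split.
  exists i; first by rewrite -(perm_mem pJ') eJ mem_cat iJ orbT.
  by rewrite (negbTE (d12 _ iJ)) ci jk.
rewrite -(perm_big _ pJ') eJ /= big_cat /= big1_seq ?add0r.
  rewrite -[RHS]cz big_seq_cond [RHS]big_seq_cond; apply: eq_bigl => i'.
  case iJ2: (i' \in J2) => //=; rewrite (negbTE (d12 _ iJ2)).
  by case: ltnP => // h; apply/eqP/eqP; lia.
by move=> i' /andP[+ i1]; rewrite i1 => /eqP e; exfalso; lia.
Qed.

Lemma has_k_disjoint_zsP k s : has_k_disjoint_zs k s <-> zs_packing k s.
Proof.
have es : s = map (fun i : 'I_(size s) => s`_i) (enum 'I_(size s)).
  by rewrite -{1}(mkseq_nth 0 s) /mkseq -val_enum_ord -map_comp.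
split=> [[I [I0 [Iz Id]]]|].
  have := zs_packing_of_disjoint_sets _ (fun i : 'I_(size s) => s`_i) k I
    [set: 'I_(size s)] I0 Iz Id (fun j => subsetT _).
  by rewrite (eq_enum (B := 'I_(size s))) -?es // => i; rewrite !inE.
rewrite {1}es => /zs_packing_coloring[|c hc]; first exact: enum_uniq.
exists (fun j : 'I_k => [set i | c i == j :> nat]); split=> [j|].
  have [[i _ ci] _] := hc j (ltn_ord j).
  by apply/set0Pn; exists i; rewrite inE ci.
split=> [j|j j' jj'].
  have [_ hz] := hc j (ltn_ord j); rewrite -[RHS]hz big_enum_cond /=.
  by apply: eq_bigl => i; rewrite inE.
apply/pred0P => i /=; rewrite !inE; apply/negP => /andP[/eqP -> /eqP e].
by move: jj'; rewrite -val_eqE /= e eqxx.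
Qed.

End ZeroSumPackings.

(** * Packing sets of non-zero elements in exponent 2 *)

Section ExponentTwo.
Import GRing.Theory.
Local Open Scope ring_scope.
Variable G : finZmodType.
Hypothesis addGG : forall x : G, x + x = 0.
Implicit Types (s b : seq G) (A B : {set G}).

Lemma zs_block_size_ge3 b :
  uniq b -> 0 \notin b -> b != [::] -> \sum_(x <- b) x = 0 -> (3 <= size b)%N.
Proof.
case: b => [|x [|y [|z b]]] //=.
  by rewrite big_seq1 inE => _ /negP n0 _ x0; case: n0; rewrite x0.
rewrite !big_cons big_nil addr0 !inE andbT => xy _ _ /eqP.
have -> : y = - y by apply/eqP; rewrite -addr_eq0 addGG.
by rewrite addr_eq0 opprK (negbTE xy).
Qed.

(** In case of equality no term is left over, so [s] is a union of zero-sum blocks. *)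
Lemma zs_packing_size_ge3 k s : uniq s -> 0 \notin s -> zs_packing G k s ->
  (3 * k <= size s)%N /\ ((3 * k)%N = size s -> \sum_(x <- s) x = 0).
Proof.
elim: k s => [|k IH] s us s0.
  by move=> _; split=> // /esym/size0nil ->; rewrite big_nil.
move=> [b [r [b0 bz p h]]].
move: us s0; rewrite (perm_uniq p) (perm_mem p) (perm_big _ p) (perm_size p).
rewrite cat_uniq mem_cat negb_or size_cat big_cat /= bz add0r.
move=> /and3P[ub _ ur] /andP[b00 r0].
have := zs_block_size_ge3 _ ub b00 b0 bz; have [IH1 IH2] := IH r ur r0 h.
by move=> hb; split=> [|e]; [|apply: IH2]; lia.
Qed.

(** [A] collects the non-zero elements of odd multiplicity; [w] splits into [n] blocks, each a
    single 0 or a pair of equal terms. *)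
Lemma odd_part_decomposition s : exists A w n,
  [/\ 0 \notin A, perm_eq s (enum A ++ w), (size w <= 2 * n)%N &
      forall k t, zs_packing G k t -> zs_packing G (n + k) (w ++ t)].
Proof.
elim: s => [|x s [A [w [n [A0 p hw hn]]]]].
  exists set0, [::], 0%N; split; rewrite ?inE //.
  by rewrite (eq_enum (B := pred0)) ?enum0 // => x; rewrite inE.
have [->|x0] := eqVneq x 0.
  exists A, (0 :: w), n.+1; split=> //.
  - by rewrite -[0 :: w]cat1s perm_sym perm_catCA /= perm_cons perm_sym.
  - by move: hw => /=; move: (size w) => m; lia.
  move=> k t /hn h; apply: (zs_packing_block G (n + k) [:: 0]) => //.
  by rewrite big_seq1.
have [xA|xA] := boolP (x \in A).
  exists (A :\ x), (x :: x :: w), n.+1; split=> //.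
  - by rewrite !inE negb_and A0 orbT.
  - rewrite -[x :: x :: w]cat1s perm_sym perm_catCA /= perm_cons.
    rewrite -[x :: w]cat1s perm_catCA perm_sym (perm_trans p) // catA perm_cat2r.
    apply: uniq_perm; rewrite /= ?enum_uniq ?mem_enum ?inE ?eqxx //.
    move=> y; rewrite in_cons !mem_enum !inE.
    by have [->|] := eqVneq y x.
  - by move: hw => /=; move: (size w) => m; lia.
  move=> k t /hn h; apply: (zs_packing_block G (n + k) [:: x; x]) => //.
  by rewrite !big_cons big_nil addr0.
exists (x |: A), w, n; split=> //.
  by rewrite !inE negb_or eq_sym x0.
rewrite (perm_trans (y := x :: enum A ++ w)) ?perm_cons //.
rewrite -cat_cons perm_cat2r.
apply: uniq_perm; rewrite /= ?enum_uniq ?mem_enum ?xA //.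
by move=> y; rewrite in_cons !mem_enum !inE.
Qed.

(* Split A into two parts of size u + 1: two of the (u + 1)^2 cross sums
   coincide. *)
Lemma zs_quadruple A u : (#|G| < u.+1 * u.+1)%N -> (2 * u.+1 <= #|A|)%N ->
  exists B : {set G}, [/\ B \subset A, #|B| = 4%N & \sum_(x in B) x = 0].
Proof.
move=> hu hA; pose X := [set x in take u.+1 (enum A)].
have cX : #|X| = u.+1.
  rewrite cardsE (card_uniqP _) ?take_uniq ?enum_uniq //.
  by rewrite size_take -cardE; case: ltnP => //; lia.
have XA : X \subset A.
  by apply/subsetP => x; rewrite inE => /mem_take; rewrite mem_enum.
have cY : (u.+1 <= #|A :\: X|)%N by rewrite cardsD (setIidPr XA) cX; lia.
pose f (p : G * G) := p.1 + p.2.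
have : ~~ dinjectiveb f [in setX X (A :\: X)].
  apply/negP => /dinjectiveP /card_in_imset e.
  have := max_card [in f @: setX X (A :\: X)].
  rewrite e cardsX cX => h.
  have : (u.+1 * u.+1 <= u.+1 * #|A :\: X|)%N by rewrite leq_mul2l cY orbT.
  by move=> /leq_trans/(_ h)/leq_ltn_trans/(_ hu); rewrite ltnn.
move=> /dinjectivePn[[x y]]; rewrite !inE /= => /andP[xX /andP[yX yA]].
move=> [[x' y']]; rewrite !inE /= => /andP[ne /andP[xX' /andP[yX' yA']]].
rewrite /f /= => e.
(* Distinct pairs with equal sums differ in both coordinates. As [X] and [A :\: X] are disjoint, the
   four elements are distinct. *)
have xx : x != x'.
  by apply: contraNneq ne => xx; move: e; rewrite xx => /addrI ->.
have yy : y != y'.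
  by apply: contraNneq ne => yy; move: e; rewrite yy => /addIr ->.
have d a c : a \in take u.+1 (enum A) -> c \notin take u.+1 (enum A) -> a != c.
  by move=> ha; apply: contraNneq => <-.
have n1 : x \notin x' |: (y |: [set y']).
  by rewrite !inE !negb_or xx !d.
have n2 : x' \notin y |: [set y'] by rewrite !inE !negb_or !d.
have n3 : y \notin [set y'] by rewrite inE.
exists (x |: (x' |: (y |: [set y']))); split.
- rewrite !subUset !sub1set yA yA' !andbT.
  by rewrite !(subsetP XA) // inE.
- by rewrite !cardsU1 n1 n2 n3 cards1.
by rewrite !big_setU1 //= big_set1 [x' + _]addrCA addrA e addGG.
Qed.

Lemma zs_packing_quadruples A u : (#|G| < u.+1 * u.+1)%N ->
  exists j, zs_packing G j (enum A) /\ (#|A| <= 4 * j + 2 * u + 1)%N.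
Proof.
move=> hu; have [n] := ubnP #|A|; elim: n A => // n IH A hA.
have [le|le] := leqP (2 * u.+1) #|A|; last by exists 0%N; split=> //; lia.
have [B [BA cB Bz]] := zs_quadruple A u hu le.
have cAB : #|A :\: B| = (#|A| - 4)%N by rewrite cardsD (setIidPr BA) cB.
have [|j [hj lj]] := IH (A :\: B); first by rewrite cAB; lia.
exists j.+1; split; last by lia.
by apply: (zs_packing_set _ _ _ B) => //; rewrite -card_gt0 cB.
Qed.

(** In exponent 2 each triple together with 0 is a subgroup of order 4, and any two of these meet
    only in 0. *)
Definition partial_spread (I : finType) (h : I -> 'I_3 -> G) : Prop :=
  [/\ forall i j (a b : 'I_3), h i a = h j b -> i = j /\ a = b,
      forall i a, h i a != 0 & forall i, \sum_a h i a = 0].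

Lemma zs_packing_triples (I : finType) (h : I -> 'I_3 -> G) (l : seq I) A :
  partial_spread I h -> uniq l -> (forall i a, i \in l -> h i a \in A) ->
  exists A', (#|A'| + 3 * size l)%N = #|A| /\
    forall k, zs_packing G k (enum A') -> zs_packing G (size l + k) (enum A).
Proof.
move=> [hi h0 hz]; elim: l A => [|i l IH] A /=.
  by exists A; rewrite muln0 addn0.
move=> /andP[il ul] hA; pose B := h i @: 'I_3.
have hinj : injective (h i) by move=> a b /hi[].
have cB : #|B| = 3%N by rewrite card_imset // card_ord.
have BA : B \subset A.
  by apply/subsetP => _ /imsetP[a _ ->]; apply: hA; rewrite mem_head.
have [j a jl|A' [cA' hA']] := IH (A :\: B) ul.
  rewrite !inE hA ?in_cons ?jl ?orbT // andbT.
  by apply/negP => /imsetP[b _ /hi[e _]]; move: il; rewrite -e jl.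
exists A'; split=> [|k /hA' hk].
  by have := subset_leq_card BA; move: cA'; rewrite cardsD (setIidPr BA) cB /=; lia.
apply: (zs_packing_set _ (size l + k) _ B) => //; first by rewrite -card_gt0 cB.
rewrite big_imset /=; last by move=> a b _ _; apply: hinj.
by rewrite -[RHS](hz i); apply: eq_bigl => a; rewrite inE.
Qed.

(* Keep the triples of the spread that lie in A, at the cost of one element
   outside A per discarded triple, and pack what is left into quadruples. *)
Lemma zs_packing_lower_bound (I : finType) (h : I -> 'I_3 -> G) A u :
  partial_spread I h -> (#|G| <= 3 * #|I| + 8)%N ->
  (#|G| < u.+1 * u.+1)%N -> 0 \notin A ->
  exists k, zs_packing G k (enum A) /\
    (#|A| <= ((#|G| + 1) %/ 3 + u + 1) + 2 * k)%N.
Proof.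
move=> hs hI hu A0; have [hi h0 hz] := hs.
pose good := [set i | [forall a, h i a \in A]].
have [j a|A' [cA' hA']] := zs_packing_triples I h (enum good) A hs (enum_uniq _).
  by rewrite mem_enum inE => /forallP/(_ a).
have [j [hj lj]] := zs_packing_quadruples A' u hu.
pose F i := if [pick a | h i a \notin A] is Some a then h i a else 0.
have hF i : i \in ~: good -> exists2 a, F i = h i a & h i a \notin A.
  rewrite /F !inE => /forallPn[a ha].
  by case: pickP => [b hb|/(_ a)]; [exists b | rewrite ha].
have Finj : {in ~: good &, injective F}.
  by move=> i i' /hF[a -> _] /hF[b -> _] /hi[].
(* Strict because 0 is outside [A] and is not a value of [F] on bad indices. *)
have cbad : (#|~: good| < #|~: A|)%N.
  rewrite [X in (_ < X)%N](cardsD1 0) inE A0 ltnS -(card_in_imset Finj); apply/subset_leq_card/subsetP.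
  by move=> _ /imsetP[i /hF[a -> ha] ->]; rewrite !inE h0 ha.
exists (size (enum good) + j)%N; split; first exact: hA'.
(* With [k] the number of blocks, [#|A| - 2k <= (#|A| - #|good|)/2 + u + 1/2], and
   [#|A| - #|good| <= #|G| - 1 - #|I|]. The constant 8 then just suffices. *)
move: cbad lj cA' hI (cardsC A) (cardsC good); rewrite -cardE /=; lia.
Qed.

End ExponentTwo.

(** * Complete mappings and partial spreads over F_2 *)

Section BinarySpaces.
Import GRing.Theory.
Local Open Scope ring_scope.

Lemma rowF2_addxx r (v : 'rV['F_2]_r) : v + v = 0.
Proof. by apply/rowP => i; rewrite !mxE; case: (v 0 i) => [[|[|]]] // ?; apply/val_inj. Qed.

Lemma card_rowF2 r : #|{: 'rV['F_2]_r}| = (2 ^ r)%N.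
Proof. by rewrite card_mx card_Fp // mul1n. Qed.

(* Multiplication by X modulo X^n + X + 1, which has no root in F_2. *)
Lemma complete_mapping_rowF2 n : (2 <= n)%N -> exists phi : 'rV['F_2]_n -> 'rV['F_2]_n,
  injective phi /\ injective (fun v => v + phi v).
Proof.
case: n => [|[|n]] // _; pose l : 'I_n.+2 := ord_max.
pose phi (v : 'rV['F_2]_n.+2) : 'rV['F_2]_n.+2 := \row_(i < n.+2)
  if i == 0 :> nat then v 0 l
  else v 0 (inord i.-1) + (if i == 1%N :> nat then v 0 l else 0).
exists phi; split=> v w /rowP e.
  have el : v 0 l = w 0 l by have := e 0; rewrite !mxE.
  apply/rowP => i; have [->//|il] := eqVneq i l.
  have hi : (i.+1 < n.+2)%N.
    by rewrite ltn_neqAle ltn_ord andbT; apply: contra il => /eqP[ei]; apply/eqP/val_inj.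
  have := e (Ordinal hi); rewrite !mxE /= el => /addIr.
  by rewrite inord_val.
(* This sum is what is added to [v_1] in coordinate 1, so [v_1] is determined, then successively
   [v_2] up to [v_l], and finally [v_0]. *)
have e0 : v 0 0 + v 0 l = w 0 0 + w 0 l by have := e 0; rewrite !mxE.
have es i : (0 < i < n.+2)%N -> v 0 (inord i) = w 0 (inord i).
  elim: i => // i IH /andP[_ hi].
  have := e (inord i.+1); rewrite !mxE inordK //= => ei.
  case: i IH hi ei => [|i] IH hi /=.
    have -> : inord 0 = 0 :> 'I_n.+2 by apply/val_inj; rewrite /= inordK.
    by rewrite e0 => /addIr.
  by rewrite !addr0 IH; [move=> /addIr | lia].
have el : v 0 l = w 0 l.
  have <- : inord n.+1 = l by apply/val_inj; rewrite /= inordK.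
  by apply: es; rewrite ltnSn.
apply/rowP => i; case: (posnP i) => [i0|i0].
  have -> : i = 0 by apply/val_inj.
  by move: e0; rewrite el => /addIr.
by have := es i; rewrite inord_val; apply; rewrite i0 ltn_ord.
Qed.

(** Reindexing by both permutations turns the sum S into S + S = 0. *)
Lemma sum_rowF2 n : (2 <= n)%N -> \sum_(v : 'rV['F_2]_n) v = 0.
Proof.
move=> /complete_mapping_rowF2[phi [i1 i2]].
have e1 : \sum_v phi v = \sum_v v by rewrite [RHS](reindex_inj i1).
rewrite (reindex_inj i2) big_split /= e1.
exact: rowF2_addxx.
Qed.

(** In dimension [2 + r], the triples (e1, v), (e2, phi v), (e1 + e2, v + phi v) cover exactly the
    vectors with non-zero first part, so the number of uncovered vectors does not grow. *)
Lemma partial_spread_rowF2 r : exists (I : finType) (h : I -> 'I_3 -> 'rV['F_2]_r),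
  partial_spread 'rV['F_2]_r I h /\ (2 ^ r <= 3 * #|I| + 8)%N.
Proof.
elim/ltn_ind: r => r IH; case: (ltnP r 4) => [r4|].
  (* The empty spread; dimension 3 is where the constant 8 comes from. *)
  exists 'I_0, (fun _ _ => 0); split; first by split=> [[]|[]|[]].
  by rewrite card_ord; case: r r4 {IH} => [|[|[|[|r]]]].
case: r IH => [|[|r]] // IH r4.
have [//|I [h [[hi h0 hz] hc]]] := IH r.
have [|phi [i1 i2]] := complete_mapping_rowF2 r; first by lia.
pose es : seq 'rV['F_2]_2 :=
  [:: delta_mx 0 0; delta_mx 0 1; delta_mx 0 0 + delta_mx 0 1].
pose psis := [:: id; phi; fun v => v + phi v].
have ues : uniq (0 :: es).
  have e12 : delta_mx 0 0 != delta_mx 0 1 :> 'rV['F_2]_2.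
    by apply/eqP => /rowP/(_ 0); rewrite !mxE.
  have n0 i : delta_mx 0 i != 0 :> 'rV['F_2]_2.
    by apply/eqP => /rowP/(_ i); rewrite !mxE !eqxx.
  rewrite /= !inE !negb_or ![0 == _]eq_sym !n0 e12 /= !andbT.
  rewrite addr_eq0 (_ : - delta_mx 0 1 = delta_mx 0 1 :> 'rV['F_2]_2) ?e12 /=.
    by rewrite eq_sym -subr_eq0 addrAC subrr add0r n0 eq_sym -subr_eq0 addrK n0.
  by apply/eqP; rewrite eq_sym -addr_eq0 rowF2_addxx.
pose h' (i : I + 'rV['F_2]_r) (a : 'I_3) : 'rV['F_2]_(2 + r) :=
  match i with
  | inl i => row_mx 0 (h i a)
  | inr v => row_mx (es`_a) (nth id psis a v)
  end.
have es0 (a : 'I_3) : es`_a != 0.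
  have /andP[+ _] := ues; apply: contra => /eqP <-.
  exact: mem_nth.
have row_mxI (x y : 'rV['F_2]_2) (v w : 'rV['F_2]_r) :
  row_mx x v = row_mx y w -> x = y /\ v = w by apply: eq_row_mx.
have r0 : row_mx (0 : 'rV['F_2]_2) (0 : 'rV['F_2]_r) = 0 by rewrite row_mx0.
exists (I + 'rV['F_2]_r)%type, h'; split; last first.
  by rewrite card_sum card_rowF2 !expnS; lia.
split=> [[i|v] [j|w] a b /= /row_mxI []|[i|v] a /=|[i|v]].
- by move=> _ /hi[-> ->].
- by move=> e; move: (es0 b); rewrite -e eqxx.
- by move=> e; move: (es0 a); rewrite e eqxx.
- move=> /eqP; have /andP[_ ues'] := ues.
  rewrite nth_uniq // => /eqP/val_inj <- e; split=> //; congr inr.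
  by case: a e => [[|[|[|]]] //= _]; [apply: i1 | apply: i2].
- apply/eqP => e; have [_ e'] := row_mxI _ _ _ _ (etrans e (esym r0)).
  by move: (h0 i a); rewrite e' eqxx.
- apply/eqP => e; have [e' _] := row_mxI _ _ _ _ (etrans e (esym r0)).
  by move: (es0 a); rewrite e' eqxx.
- have hi0 : \sum_(a < 3) row_mx (0 : 'rV['F_2]_2) (h i a) = 0.
    rewrite -[RHS]r0 -(hz i) !big_ord_recl !big_ord0 /= !addr0.
    by rewrite !add_row_mx !addr0.
  exact: hi0.
have hv0 : \sum_(a < 3) row_mx es`_a (nth id psis a v) = 0.
  rewrite !big_ord_recl !big_ord0 /= !addr0 !add_row_mx /=.
  by rewrite (addrA (delta_mx 0 0)) (addrA v) !rowF2_addxx r0.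
exact: hv0.
Qed.

Lemma modn3_expn2 r : (2 ^ r %% 3 != 0)%N.
Proof. by elim: r => // r; rewrite expnS; lia. Qed.

End BinarySpaces.

(** * From packings of sets to D_k and D_0 *)

Section DavenportOffset.
Import GRing.Theory.
Local Open Scope ring_scope.
Variable G : finZmodType.
Hypothesis addGG : forall x : G, x + x = 0.

Definition zs_deficit_le (M : nat) : Prop := forall A : {set G}, 0 \notin A ->
  exists k, zs_packing G k (enum A) /\ (#|A| <= M + 2 * k)%N.

(** Parity absorbs the extra 1: the sizes give [2(n + j) >= 2k - 1], hence [n + j >= k]. *)
Lemma Dk_prop_of_deficit M k :
  zs_deficit_le M.+1 -> Dk_prop G k (M + k * 2).
Proof.
move=> hM s hs; apply/has_k_disjoint_zsP.
have [A [w [n [A0 p hw hn]]]] := odd_part_decomposition G addGG s.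
have [j [hj lj]] := hM A A0.
apply: (zs_packing_leq _ _ (n + j)); last first.
  apply: (zs_packing_perm _ _ (w ++ enum A)); last exact: hn.
  by rewrite perm_sym (perm_trans p) // perm_catC.
move: hs; rewrite (perm_size p) size_cat -cardE.
by move: (size w) hw lj => m /=; lia.
Qed.

(** Padding [A] with [k - k0.+1] pairs of [g] gives length at least [M + 2k - 1]; [k] blocks there
    would leave [k0.+1] blocks in [A]. *)
Lemma leq_of_Dk_prop M k l (g : G) (A : {set G}) k0 : g != 0 ->
  (M.+1 + 2 * k0 <= #|A|)%N -> ~ zs_packing G k0.+1 (enum A) ->
  (k0 < k)%N -> Dk_prop G k l -> (M + k * 2 <= l)%N.
Proof.
move=> g0 hA hk0 kk hl; rewrite leqNgt; apply/negP => ll; apply: hk0.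
apply: (zs_packing_remove_pairs _ (k - k0.+1) _ g) => //.
rewrite subnK //; apply/has_k_disjoint_zsP/hl.
by rewrite size_cat size_nseq -cardE; lia.
Qed.

Lemma is_exponent2 g : g != 0 :> G -> is_exponent G 2.
Proof.
move=> g0; split=> //; split=> [x|[|[|n]] // _ h]; first by rewrite mulr2n.
by have := h g; rewrite mulr1n => e; rewrite e eqxx in g0.
Qed.

(* k disjoint zero-sum subsequences of A, together with n pairs of equal terms,
   give k + n of them, and nothing better is possible; hence D_0 + 1 is the
   maximum of #|A| - 2 k over sets A of non-zero elements, where k is the
   largest size of a zero-sum packing of A. *)
Lemma is_D0_of_deficit M g : g != 0 :> G -> zs_deficit_le M.+1 ->
  ~ zs_deficit_le M -> is_D0 G M.
Proof.
move=> g0 hM hM'; exists 2; split; first exact: is_exponent2 g0.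
have [A hA] := not_all_ex_not _ _ hM'.
have [A0 {}hA] := imply_to_and _ _ hA.
have [k0 [hk0 lk0]] := hM A A0.
have lk k : zs_packing G k (enum A) -> (M.+1 + 2 * k <= #|A|)%N.
  by move=> hk; rewrite leqNgt; apply/negP => h; apply: hA; exists k.
exists k0.+1 => k kk; split; first exact: Dk_prop_of_deficit.
move=> l; apply: (leq_of_Dk_prop M k l g A k0) => //; first exact: lk.
by move=> /lk; lia.
Qed.

(** Descends from [n] to a bound that cannot be lowered further; the lower bound [m] stops the
    descent. *)
Lemma exists_is_D0 n m g : g != 0 :> G -> zs_deficit_le n.+1 ->
  (forall M, zs_deficit_le M -> (m < M)%N) ->
  exists d0, is_D0 G d0 /\ (m <= d0 <= n)%N.
Proof.
move=> g0 + hm; elim: n => [|n IH] hn.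
  have h := hm _ hn; exists 0%N; split; last by lia.
  by apply: (is_D0_of_deficit 0 g g0 hn) => /hm; lia.
have [/IH[d0 [h1 h2]]|h] := classic (zs_deficit_le n.+1).
  by exists d0; split=> //; lia.
exists n.+1; split; first exact: (is_D0_of_deficit _ g g0 hn h).
by have := hm _ hn; lia.
Qed.

End DavenportOffset.

(** * Both deficit bounds for C_2^r *)

Section BinaryDeficit.
Import GRing.Theory.
Local Open Scope ring_scope.

Lemma zs_deficit_le_rowF2 r u : (2 ^ r < u.+1 * u.+1)%N ->
  zs_deficit_le (C2r r) ((2 ^ r - 1 + 2) %/ 3 + u).+1.
Proof.
move=> hu A A0; have [I [h [hs hI]]] := partial_spread_rowF2 r.
have cG : #|C2r r| = (2 ^ r)%N := card_rowF2 r.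
have [|||k [hk lk]] := zs_packing_lower_bound (C2r r) (@rowF2_addxx r) I h A u hs.
- by rewrite cG.
- by rewrite cG.
- by [].
exists k; split=> //; move: lk; rewrite cG.
have : (0 < 2 ^ r)%N by rewrite expn_gt0.
by move: (2 ^ r)%N => q q0 /=; lia.
Qed.

Lemma rowF2_neq0 r : (0 < r)%N -> exists g : 'rV['F_2]_r, g != 0.
Proof.
case: r => // r _; exists (delta_mx 0 0).
by apply/eqP => /rowP/(_ 0); rewrite !mxE !eqxx.
Qed.

(* All non-zero elements but one: the blocks have size at least 3, and a perfect
   partition into triples would make the omitted element 0. *)
Lemma zs_deficit_rowF2_gt r M : (2 <= r)%N -> zs_deficit_le (C2r r) M ->
  ((2 ^ r - 1 + 2) %/ 3 < M)%N.
Proof.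
move=> hr hM; have [|x x0] := rowF2_neq0 r; first exact: ltnW.
pose A : {set C2r r} := ~: [set 0; x].
have cG : #|C2r r| = (2 ^ r)%N := card_rowF2 r.
have cA : (#|A| + 2)%N = (2 ^ r)%N.
  by rewrite -cG -(cardsC A) setCK cards2 eq_sym x0.
have A0 : 0 \notin A by rewrite !inE eqxx.
have [k [hk lk]] := hM A A0.
have [||h3 e3] := zs_packing_size_ge3 (C2r r) (@rowF2_addxx r) k (enum A) _ _ hk.
- exact: enum_uniq.
- by rewrite mem_enum.
have ne : (3 * k)%N <> #|A|.
  rewrite cardE => /e3; rewrite big_enum /= => zA.
  have := sum_rowF2 r hr; rewrite (bigID (fun v => v \in A)) /=.
  have -> : \sum_(v in A) v = 0 :> 'rV['F_2]_r := zA.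
  rewrite add0r (bigD1 0) ?(negbTE A0) //= add0r (bigD1 x) /=; last first.
    by rewrite !inE eqxx orbT x0.
  rewrite big1 => [|v]; last by rewrite !inE negbK; case: eqP; case: eqP.
  by rewrite addr0 => e; rewrite e eqxx in x0.
(* If [2 ^ r] is 2 mod 3, [ne] lowers [k] by one; if it is 1, rounding suffices; residue 0 would
   fall one short. *)
have := modn3_expn2 r; rewrite -cardE in h3.
move: cA h3 ne lk => /=; move: #|A| (2 ^ r)%N => a q *; lia.
Qed.

End BinaryDeficit.

(** * Integer square roots and the passage to real numbers *)

Lemma exists_sqrt n : exists u, (u * u <= n < u.+1 * u.+1)%N.
Proof.
elim: n => [|n [u hu]]; first by exists 0.
have [h|h] := leqP (u.+1 * u.+1) n.+1; first by exists u.+1; nia.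
by exists u; lia.
Qed.

Lemma INR_expn m n : INR (m ^ n) = pow (INR m) n.
Proof. by elim: n => //= n IH; rewrite expnS mult_INR IH. Qed.

Lemma INR_le_Rpower_half u r :
  (u * u <= 2 ^ r)%N -> Rle (INR u) (Rpower (INR 2) (Rdiv (INR r) (INR 2))).
Proof.
move=> h; apply: Rsqr_incr_0_var; last exact/Rlt_le/exp_pos.
rewrite /Rsqr -mult_INR -Rpower_plus.
have -> : Rplus (Rdiv (INR r) (INR 2)) (Rdiv (INR r) (INR 2)) = INR r.
  by simpl; lra.
rewrite Rpower_pow; last by simpl; lra.
by rewrite -INR_expn; apply/le_INR/leP.
Qed.

Theorem theorem7p14 (r : nat) (hr : (2 <= r)%N) :
  exists d0 : nat, is_D0 (C2r r) d0 /\
    ((2 ^ r - 1 + 2) %/ 3 <= d0)%N /\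
    Rle (INR d0) (Rplus (INR ((2 ^ r - 1 + 2) %/ 3)%N) (Rpower (INR 2) (Rdiv (INR r) (INR 2)))).
Proof.
(* [u] is the integer part of 2^(r/2): [hu2] drives the pigeonhole, [hu1] the real estimate. *)
have [u /andP[hu1 hu2]] := exists_sqrt (2 ^ r).
have [|g g0] := rowF2_neq0 r; first exact: ltnW.
have [d0 [h0 /andP[h1 h2]]] := exists_is_D0 (C2r r) (@rowF2_addxx r) _ _ g g0
  (zs_deficit_le_rowF2 r u hu2) (fun M => zs_deficit_rowF2_gt r M hr).
exists d0; do !split=> //.
apply: (Rle_trans _ (INR ((2 ^ r - 1 + 2) %/ 3 + u)%N)); first exact/le_INR/leP.
by rewrite plus_INR; apply/Rplus_le_compat_l/INR_le_Rpower_half.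
Qed.
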